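(* Let $\mu$ be a Borel measure on $\mathbb{R}$ and let $\mathcal{K}$ be the restriction of the mean $\mathcal{M}^{\mu}$ to bounded sets. Let $H\subset\mathbb{R}$ be such that $\hat{\mathcal{K}}(H\cap(-\infty,0])$ and $\hat{\mathcal{K}}(H\cap[0,+\infty))$ exist. If $\hat{\mathcal{K}}(H\cap(-\infty,0])>-\infty$ and $\hat{\mathcal{K}}(H\cap[0,+\infty))<+\infty$, then $\hat{\mathcal{K}}(H)$ exists and $|\hat{\mathcal{K}}(H)|<+\infty$.
   Context: For a Borel measure $\mu$ on $\mathbb{R}$ and a $\mu$-measurable $H\subset\mathbb{R}$ with $0<\mu(H)<+\infty$, $\mathcal{M}^{\mu}(H)=\frac{\int_H x\,d\mu}{\mu(H)}$. For $\mathcal{K}=\mathcal{M}^{\mu}$ restricted to bounded sets, and a $\mu$-measurable $L\subset\mathbb{R}$ such that $\mu(L)>0$ and $\mu(L\cap[x,y])<+\infty$ for all real $x\le y$, the extension is $\hat{\mathcal{K}}(L)=\lim_{x\to-\infty,\,y\to+\infty}\mathcal{M}^{\mu}(L\cap[x,y])$ if this double limit ($x,y$ tending independently, over those $x\le y$ with $\mu(L\cap[x,y])>0$, which holds for all sufficiently small $x$ and large $y$) exists in $\bar{\mathbb{R}}=\mathbb{R}\cup\{-\infty,+\infty\}$. Saying that $\hat{\mathcal{K}}(L)$ exists means that $L$ is a $\mu$-measurable set satisfying these conditions and that the limit exists. *)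

(* Defs.v *)
From HB Require Import structures.
From mathcomp Require Import all_boot all_order all_algebra.
From mathcomp Require Import all_classical all_reals all_analysis.

Set Implicit Arguments.
Unset Strict Implicit.
Unset Printing Implicit Defensive.

Import Order.TTheory GRing.Theory Num.Theory.
Import numFieldNormedType.Exports.

Local Open Scope classical_set_scope.
Local Open Scope ring_scope.
Local Open Scope ereal_scope.

(* The library leaves the measure argument implicit. *)
Notation completed mu := (@completed_measure_extension _ _ _ mu).

(* A Borel measure need not be locally finite nor sigma-finite. Its measurable
   sets are the Caratheodory measurable sets of the outer measure mu^*. On a set
   L whose traces on bounded intervals have finite measure, this amounts to
   being measurable for the completion of mu (a Borel set up to a mu-negligible
   set). *)
Definition mu_measurable (R : realType)
    (mu : {measure set (measurableTypeR R) -> \bar R}) (L : set R) : Prop :=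
  (mu^*)%mu.-cara.-measurable L.

(* Only meaningful when L is mu-measurable with finite positive measure. *)
Definition mean (R : realType)
    (mu : {measure set (measurableTypeR R) -> \bar R}) (L : set R) : \bar R :=
  (\int[completed mu]_(x in L) (x : R)%:E)
    / completed mu L.

(* x and y tend independently to -oo and +oo, through the pairs x <= y such
   that L meets [x, y] in a set of positive measure. *)
Definition trunc_filter (R : realType)
    (mu : {measure set (measurableTypeR R) -> \bar R}) (L : set R) :
    set_system (R * R) :=
  within
    [set p | (p.1 <= p.2)%R /\
             0 < completed mu (L `&` `[p.1, p.2])]
    (filter_prod (ninfty_nbhs R) (pinfty_nbhs R)).

(* The sets L `&` `[x, y] are bounded: only the restriction of the mean to
   bounded sets is used. *)
Definition trunc_mean (R : realType)
    (mu : {measure set (measurableTypeR R) -> \bar R}) (L : set R)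
    (p : R * R) : \bar R :=
  mean mu (L `&` `[p.1, p.2]).

Definition ext_mean_exists (R : realType)
    (mu : {measure set (measurableTypeR R) -> \bar R}) (L : set R) : Prop :=
  [/\ mu_measurable mu L,
      0 < completed mu L,
      forall x y : R, (x <= y)%R ->
        completed mu (L `&` `[x, y]) < +oo
    & cvg (trunc_mean mu L @ trunc_filter mu L)].

(* Only meaningful under ext_mean_exists mu L. *)
Definition ext_mean (R : realType)
    (mu : {measure set (measurableTypeR R) -> \bar R}) (L : set R) : \bar R :=
  lim (trunc_mean mu L @ trunc_filter mu L).

(* Main.v *)
Require Import Defs.
From HB Require Import structures.
From mathcomp Require Import all_boot all_order all_algebra.
From mathcomp Require Import all_classical all_reals all_analysis.
From mathcomp Require Import measurable_realfun lra.

Set Implicit Arguments.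
Unset Strict Implicit.
Unset Printing Implicit Defensive.

Import Order.TTheory GRing.Theory Num.Theory.
Import numFieldNormedType.Exports.

Local Open Scope classical_set_scope.
Local Open Scope ring_scope.
Local Open Scope ereal_scope.

(** The one-sided means force [mu] to be small at infinity. Suppose that [L] lies
    in [0, +oo) and that its truncated means stay below some [K > 0]. At least
    half of the mass of each trace [E] of [L] on a bounded interval must sit in
    [0, 2K]: otherwise the part beyond [2K] alone would make the integral of [x]
    over [E] exceed [K * mu E] (Markov's inequality). As [L] has finite mass in
    [0, 2K], the masses of its bounded traces are bounded, so [mu L] is finite,
    and the integral of [x] over [L] is at most [K * mu L]. This is
    [integrable_of_bounded_averages], stated for a measurable function [X] whose
    absolute value is averaged, which treats both half-lines at once.

    Under the hypotheses both halves of [H] are thus of finite measure with [x]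
    integrable, hence so is [H]. No competition between two infinite tails is
    left: the integral of [x] over the trace of [H] on [[x, y]] and the measure
    of this trace converge separately, as [x] and [y] go to infinity
    independently, to the integral and the measure over [H]
    ([cvg_Rintegral_window]). The limit of the means is the ordinary mean of [H],
    which is finite. *)

(** * Traces of a set on bounded intervals *)

(** On an abstract space with a function [X] in place of the identity of the
    real line, so that the results apply to the line equipped with its
    Caratheodory measurable sets without unfolding that structure. *)
Definition window {T : Type} {R : realType} (X : T -> R) (L : set T)
  (p : R * R) : set T := L `&` X @^-1` `[p.1, p.2].

Definition symm {R : realType} (n : nat) : R * R := ((- n%:R)%R, n%:R).

(** Lets an eventual property of pairs of endpoints be tested along a sequence,
    as monotone convergence requires. *)
Lemma cvg_symm (R : realType) :
  symm n @[n --> \oo] --> filter_prod (ninfty_nbhs R) (pinfty_nbhs R).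
Proof.
have cvgN : (- n%:R : R)%R @[n --> \oo] --> -oo%R.
  by apply/cvgNrNy; exact: cvgr_idn.
exact: (cvg_pair cvgN cvgr_idn).
Qed.

Lemma window_mono (T : Type) (R : realType) (X : T -> R) (L : set T) p q :
  (q.1 <= p.1)%R -> (p.2 <= q.2)%R -> window X L p `<=` window X L q.
Proof.
move=> qp pq x [Lx] /=; rewrite !in_itv /= => /andP[px xp]; split=> //=.
by rewrite in_itv /= (le_trans qp) ?(le_trans xp).
Qed.

Lemma nondecreasing_window (T : Type) (R : realType) (X : T -> R) (L : set T) :
  {homo (fun n => window X L (symm n)) : n m / (n <= m)%N >-> (n <= m)%O}.
Proof.
move=> n m nm; apply/subsetPset/window_mono => /=; last by rewrite ler_nat.
by rewrite lerN2 ler_nat.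
Qed.

Lemma bigcup_window (T : Type) (R : realType) (X : T -> R) (L : set T) :
  \bigcup_n window X L (symm n) = L.
Proof.
apply/seteqP; split=> [x [n _ []]//|x Lx].
exists (Num.trunc `|X x|).+1 => //; split => //=.
by rewrite in_itv /= -ler_norml ltW// truncnS_gt.
Qed.

(** * Integrals and averages over large traces *)

Section windows.
Context d (T : measurableType d) (R : realType).
Context (nu : {measure set T -> \bar R}).
Variables (X : T -> R) (L : set T).
Hypotheses (mX : measurable_fun setT X) (mL : measurable L).

Let W p := window X L p.

Lemma measurable_window p : measurable (W p).
Proof.
apply: measurableI => //; rewrite -[X in measurable X]setTI; exact: mX.
Qed.
Let mW := measurable_window.

(** The error made on the trace over [p] is at most the integral of [`|g|] outside
    the trace over any [[-n, n]] contained in the interval of [p], and the latter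
    tends to 0 by monotone convergence. Domination by a single sequence is what
    makes the limit hold for independent endpoints. *)
Lemma cvg_Rintegral_window (g : T -> R) : nu.-integrable L (EFin \o g) ->
  (\int[nu]_(x in W p) g x)%R
    @[p --> filter_prod (ninfty_nbhs R) (pinfty_nbhs R)] -->
  (\int[nu]_(x in L) g x)%R.
Proof.
move=> ig.
have ign : nu.-integrable L (EFin \o (fun x => `|g x|%R)).
  exact: integrable_norm.
have cn : (\int[nu]_(x in W (symm n)) `|g x|)%R @[n --> \oo]
    --> (\int[nu]_(x in L) `|g x|)%R.
  apply/fine_cvg; rewrite fineK; last exact: integrable_fin_num ign.
  rewrite -[X in _ --> \int[_]_(_ in X) _](bigcup_window X L).
  apply: ge0_nondecreasing_set_cvg_integral => //.
  - exact: nondecreasing_window.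
  - move=> n; apply: measurable_funS mL _ (measurable_int _ ign).
    by move=> x [].
have split_window h p : nu.-integrable L (EFin \o h) ->
    (\int[nu]_(x in L) h x - \int[nu]_(x in W p) h x =
     \int[nu]_(x in L `\` W p) h x)%R.
  move=> ih; have WL : W p `<=` L by move=> x [].
  have mLW : measurable (L `\` W p) by exact: measurableD.
  have -> : (\int[nu]_(x in L) h x)%R =
      (\int[nu]_(x in W p) h x + \int[nu]_(x in L `\` W p) h x)%R.
    rewrite -Rintegral_setU// ?setDUK//.
    by apply/disj_set2P; rewrite setDIK.
  by rewrite addrAC subrr add0r.
apply/cvgrPdist_lt => e e0.
move/cvgrPdist_lt/(_ _ e0): cn => [n _ /(_ n (leqnn _)) ne].
exists ([set x | (x < - n%:R)%R], [set y | (n%:R < y)%R]).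
  split; [exists (- n%:R)%R | exists n%:R]; split=> //;
    by rewrite realE ?oppr_le0 ?ler0n ?orbT.
move=> p [/= p1 p2]; apply: le_lt_trans ne.
rewrite !split_window//; apply: le_trans (ler_norm _).
apply: le_trans (le_normr_Rintegral _ _) _.
- exact: measurableD.
- by apply: integrableS ig => //; exact: measurableD.
have mLW q : measurable (L `\` W q) by exact: measurableD.
have ignW q : nu.-integrable (L `\` W q) (EFin \o (fun x => `|g x|%R)).
  by apply: integrableS ign => // ? [].
apply: fine_le; [exact: integrable_fin_num (ignW _)..|].
apply: ge0_subset_integral => //; first exact: measurable_int (ignW _).
by apply: setDS; apply: window_mono; rewrite /= ltW.
Qed.

Lemma cvg_measure_window : nu L < +oo ->
  fine (nu (W p)) @[p --> filter_prod (ninfty_nbhs R) (pinfty_nbhs R)]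
    --> fine (nu L).
Proof.
move=> Loo.
have i1 : nu.-integrable L (EFin \o (cst 1%R)).
  apply/integrableP; split.
    by apply/measurable_EFinP; exact: measurable_cst.
  by rewrite /= normr1 integral_cst// mul1e.
have := cvg_Rintegral_window i1.
rewrite Rintegral_cst// mul1r.
by under eq_fun do rewrite Rintegral_cst// mul1r.
Qed.

Lemma cvg_average_window : 0 < nu L -> nu L < +oo ->
  nu.-integrable L (EFin \o X) ->
  (\int[nu]_(x in W p) (X x)%:E) / nu (W p)
    @[p --> filter_prod (ninfty_nbhs R) (pinfty_nbhs R)] -->
  ((\int[nu]_(x in L) X x)%R / fine (nu L))%:E.
Proof.
move=> L0 Loo iX.
have fL0 : (0 < fine (nu L))%R by rewrite fine_gt0// L0.
have W0 : \forall p \near filter_prod (ninfty_nbhs R) (pinfty_nbhs R),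
    (0 < fine (nu (W p)))%R.
  exact: cvgr_gt (cvg_measure_window Loo) _ fL0.
apply: cvg_trans (_ : ((\int[nu]_(x in W p) X x)%R / fine (nu (W p)))%:E
  @[p --> filter_prod (ninfty_nbhs R) (pinfty_nbhs R)] --> _).
  apply: near_eq_cvg; near=> p.
  have Wp0 : (0 < fine (nu (W p)))%R by near: p.
  have Wfin : nu (W p) \is a fin_num.
    rewrite ge0_fin_numE//; apply: le_lt_trans Loo.
    by apply: le_measure; rewrite ?inE// => ? [].
  rewrite -[in RHS](fineK Wfin) inver gt_eqF// EFinM fineK//.
  by apply: integrable_fin_num => //; apply: integrableS iX => // ? [].
apply: cvg_EFin; first exact: nearW.
apply: cvgM; first exact: cvg_Rintegral_window.
by apply: cvgV; [rewrite gt_eqF|exact: cvg_measure_window].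
Unshelve. all: by end_near.
Qed.

(** Markov's inequality at level [2K]: if the average of [`|X|] over a trace is at
    most [K], then [`|X| >= 2K] holds on at most half of its mass. The measure of
    every such trace is therefore at most twice that of the fixed trace where
    [`|X| <= 2K]. *)
Lemma integrable_of_bounded_averages (K : R) : (0 < K)%R ->
  (forall p, nu (W p) < +oo) ->
  (\forall n \near \oo, 0 < nu (W (symm n)) ->
     \int[nu]_(x in W (symm n)) `|X x|%:E <= K%:E * nu (W (symm n))) ->
  nu L < +oo /\ nu.-integrable L (EFin \o X).
Proof.
move=> K0 Woo posW.
pose E n := W (symm n).
have ndE : {homo E : n m / (n <= m)%N >-> (n <= m)%O}.
  exact: nondecreasing_window.
have UE : \bigcup_n E n = L := bigcup_window X L.
have mXn : measurable_fun setT (fun x => `|X x|%:E).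
  by apply/measurable_EFinP; exact: measurableT_comp.
have avgW : \forall n \near \oo,
    \int[nu]_(x in E n) `|X x|%:E <= K%:E * nu (E n).
  apply: filterS posW => n posn; have [En0|En0] := eqVneq (nu (E n)) 0.
    by rewrite En0 mule0 (null_set_integral (mW _) (measurable_funTS mXn) En0).
  by apply: posn; rewrite lt0e En0 measure_ge0.
pose c := fine (nu (W (- (K *+ 2), K *+ 2)%R)).
have bE : \forall n \near \oo, nu (E n) <= (c *+ 2)%:E.
  near=> n.
  have avgn : \int[nu]_(x in E n) `|X x|%:E <= K%:E * nu (E n) by near: n.
  pose A := E n `&` [set x | (K *+ 2)%:E <= `|(X x)%:E|].
  have mA : measurable A.
    exact: (emeasurable_fun_c_infty (mW _) (measurable_funTS mXn)).
  have markov : (K *+ 2)%:E * nu A <= \int[nu]_(x in E n) `|X x|%:E.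
    apply: (@le_integral_comp_abse _ _ _ nu _ (mW _) (EFin \o X) _ id) => //.
    - by apply/measurable_EFinP; exact: measurable_funTS.
    - by rewrite mulrn_wgt0.
  have EA : nu (E n) <= c%:E + nu A.
    rewrite /c fineK; last by rewrite ge0_fin_numE.
    apply: le_trans (measureU2 nu (mW _) mA).
    apply: le_measure; rewrite ?inE; [exact: mW|exact: measurableU|].
    move=> x Enx; have [xK|xK] := leP (K *+ 2)%R `|X x|%R; [right|left].
      by split => //=; rewrite lee_fin.
    by split; [case: Enx | rewrite /= in_itv /= -ler_norml ltW].
  have Enfin : nu (E n) \is a fin_num by rewrite ge0_fin_numE//; exact: Woo.
  have Afin : nu A \is a fin_num.
    rewrite ge0_fin_numE//; apply: le_lt_trans (Woo (symm n)).
    by apply: le_measure; rewrite ?inE; [exact: mA|exact: mW|move=> ? []].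
  have {markov avgn} := le_trans markov avgn.
  (* With e and r the measures of E n and A: e <= c + r and 2 r <= e. *)
  move: EA; rewrite -(fineK Enfin) -(fineK Afin) -EFinD -!EFinM !lee_fin.
  set e := fine _; set r := fine _ => er; rewrite mulrnAl -mulrnAr.
  rewrite ler_pM2l// => re.
  lra.
have Lc : nu L <= (c *+ 2)%:E.
  apply: (@cvge_le _ _ _ _ (nu \o E) _ _ bE).
  rewrite -UE; apply: nondecreasing_cvg_mu ndE; last by rewrite UE.
  by move=> n; exact: mW.
have Loo : nu L < +oo by exact: le_lt_trans Lc (ltry _).
split => //; apply/integrableP; split.
  by apply/measurable_EFinP; exact: measurable_funTS.
apply: (@le_lt_trans _ _ (K%:E * nu L)); last first.
  by rewrite lte_mul_pinfty// ?lee_fin ltW.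
have := @ge0_nondecreasing_set_cvg_integral _ _ _ E (fun x => `|X x|%:E) nu ndE
  (fun n => mW _) (fun n => measurable_funTS mXn) (fun n x _ => normr_ge0 _).
rewrite UE; apply: cvge_le; near=> n.
apply: le_trans (_ : K%:E * nu (E n) <= _); first by near: n.
rewrite lee_pmul2l ?lte_fin//.
by apply: le_measure; rewrite ?inE; [exact: mW|exact: mL|move=> ? []].
Unshelve. all: end_near.
Qed.

End windows.

Lemma integrable_setU d (T : measurableType d) (R : realType)
    (nu : {measure set T -> \bar R}) (A B : set T) (f : T -> \bar R) :
    measurable A -> measurable B ->
  nu.-integrable A f -> nu.-integrable B f -> nu.-integrable (A `|` B) f.
Proof.
move=> mA mB iA iB; apply/integrableP; split.
  by apply/measurable_funU => //; split; apply: measurable_int; eassumption.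
have mBA : measurable (B `\` A) by exact: measurableD.
have iBA : nu.-integrable (B `\` A) f.
  exact: integrableS mB mBA (@subDsetl _ _ _) iB.
have -> : A `|` B = A `|` (B `\` A) by rewrite setUDr setDv setD0.
have AB0 : [disjoint A & B `\` A] by apply/disj_set2P; rewrite setDIK.
move/integrableP: iA => [mfA Aoo]; move/integrableP: iBA => [mfB Boo].
rewrite ge0_integral_setU//; first exact: lte_add_pinfty.
by apply: measurableT_comp => //; apply/measurable_funU.
Qed.

(** * Truncated means on the line *)

Section Caratheodory_line.
Context (R : realType) (mu : {measure set (measurableTypeR R) -> \bar R}).

Let T := caratheodory_type (mu^*)%mu.

Lemma mu_measurable_itv (i : interval R) : mu_measurable mu [set` i].
Proof.
apply: sub_caratheodory; apply: sub_sigma_algebra; exact: measurable_itv.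
Qed.

Lemma measurable_id_cara : measurable_fun setT (id : T -> R).
Proof.
move=> _ B mB; rewrite setTI; apply: sub_caratheodory; exact: sub_sigma_algebra.
Qed.
Let mX := measurable_id_cara.

(** The equality of the integral of [`|x|] with the modulus of the integral of [x]
    is how a set lying on one side of 0 enters; it turns a bound on the truncated
    means into one on the averages of [`|x|]. *)
Lemma integrable_of_bounded_trunc_mean (L : set R) (K : R) :
    ext_mean_exists mu L -> (0 < K)%R ->
    (forall A, mu_measurable mu A -> A `<=` L ->
      \int[completed mu]_(x in A) `|x : R|%:E
      = `|\int[completed mu]_(x in A) (x : R)%:E|) ->
    (\forall p \near trunc_filter mu L, `|trunc_mean mu L p| < K%:E) ->
  completed mu L < +oo /\ (completed mu).-integrable L (EFin \o (id : T -> R)).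
Proof.
move=> [mL L0 Lfin _] K0 sgn bnd.
have Woo p : completed mu (window (id : T -> R) L p) < +oo.
  have [p12|p21] := leP p.1 p.2; first exact: Lfin.
  rewrite (_ : window _ _ _ = set0) ?measure0//.
  apply/seteqP; split => // x [_ /=]; rewrite in_itv /= => /andP[px xp].
  by move: (le_trans px xp); rewrite leNgt p21.
apply: (integrable_of_bounded_averages mX mL K0 Woo).
have bndn : \forall n \near \oo,
    ((symm n).1 <= (symm n).2 :> R)%R /\
      0 < completed mu (window (id : T -> R) L (symm n)) ->
    `|mean mu (window (id : T -> R) L (symm n))| < K%:E := cvg_symm bnd.
apply: filterS bndn => n; set W := window _ _ _ => meanW W0.
have {}W0 : 0 < completed mu W := W0.
change (is_true
  (\int[completed mu]_(x in W) `|x : R|%:E <= K%:E * completed mu W)).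
have mW : measurable W by exact: measurable_window.
have Wfin : completed mu W \is a fin_num.
  by rewrite ge0_fin_numE//; exact: Woo.
have fW0 : (0 < fine (completed mu W))%R.
  by rewrite fine_gt0// W0 -ge0_fin_numE.
have sn : ((symm n).1 <= (symm n).2 :> R)%R.
  by apply: le_trans (ler0n _ n); rewrite oppr_le0.
move: (meanW (conj sn W0)); rewrite /mean abseM -sgn//; last by move=> ? [].
rewrite -(fineK Wfin) inver gt_eqF// gee0_abs; last first.
  by rewrite lee_fin invr_ge0 ltW.
by move=> /ltW; rewrite lee_pdivrMr.
Qed.

Lemma cvg_trunc_mean (L : set R) : mu_measurable mu L -> 0 < completed mu L ->
    completed mu L < +oo ->
    (completed mu).-integrable L (EFin \o (id : T -> R)) ->
  exists l : R, trunc_mean mu L @ trunc_filter mu L --> l%:E.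
Proof.
move=> mL L0 Loo iX.
eexists; apply: cvg_trans (cvg_average_window mX mL L0 Loo iX).
by apply: cvg_app; exact: cvg_within.
Qed.

(** Makes limits along this filter unique, so that [lim] is the limit found. The
    condition of positive measure is eventually met because the measures of the
    traces tend to that of [L]. *)
Lemma trunc_filter_proper (L : set R) : mu_measurable mu L ->
    0 < completed mu L -> completed mu L < +oo ->
  ProperFilter (trunc_filter mu L).
Proof.
move=> mL L0 Loo.
apply: Build_ProperFilter_ex.
move=> P; rewrite /trunc_filter /within /= => PF.
have LW : \forall p \near filter_prod (ninfty_nbhs R) (pinfty_nbhs R),
    (0 < fine (completed mu (window (id : T -> R) L p)))%R.
  by apply: cvgr_gt (cvg_measure_window mX mL Loo) _ _; rewrite fine_gt0// L0.
have p12 : \forall p \near filter_prod (ninfty_nbhs R) (pinfty_nbhs R),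
    (p.1 <= p.2)%R.
  exists ([set x | (x < 0)%R], [set y | (0 < y)%R]).
    by split; exists 0%R; split.
  by move=> p [/= p1 p2]; rewrite ltW// (lt_trans p1).
have [p [[Pp Wp] lp]] := filter_ex (filterI (filterI PF LW) p12).
exists p; apply: Pp; split => //=.
rewrite lt0e measure_ge0 andbT; apply: contraTneq Wp => /= ->.
by rewrite ltxx.
Qed.

(** The truncated means are nonnegative, so an upper bound bounds their modulus. *)
Lemma integrable_of_ext_mean_ltpinfty (L : set R) :
    L `<=` [set x | (0 <= x)%R] -> ext_mean_exists mu L ->
    ext_mean mu L < +oo ->
  completed mu L < +oo /\ (completed mu).-integrable L (EFin \o (id : T -> R)).
Proof.
move=> L_ge0 LE Llt; have [_ _ _ cL] := LE.
have int_ge0 (A : set R) : A `<=` L ->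
    0 <= \int[completed mu]_(x in A) (x : R)%:E.
  by move=> AL; apply: integral_ge0 => x Ax; rewrite lee_fin L_ge0//; exact: AL.
have [K K0 LK] : exists2 K : R, (0 < K)%R & ext_mean mu L < K%:E.
  case: (ext_mean mu L) Llt => // [r _|_]; last first.
    by exists 1%R => //; exact: ltNyr.
  exists (`|r| + 1)%R; first exact: ltr_wpDl.
  by rewrite lte_fin (le_lt_trans (ler_norm _))// ltrDl.
have LtK : \forall p \near trunc_filter mu L, trunc_mean mu L p < K%:E.
  exact: cL (open_ereal_lt' LK).
apply: (integrable_of_bounded_trunc_mean LE K0) => [A _ AL|].
  rewrite gee0_abs ?int_ge0//; apply: eq_integral => x /set_mem Ax.
  by rewrite ger0_norm// L_ge0//; exact: AL.
apply: filterS LtK => p; rewrite gee0_abs// /trunc_mean /mean.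
by rewrite mule_ge0 ?inve_ge0 ?int_ge0// => ? [].
Qed.

Lemma integrable_of_ext_mean_gtninfty (L : set R) :
    L `<=` [set x | (x <= 0)%R] -> ext_mean_exists mu L ->
    -oo < ext_mean mu L ->
  completed mu L < +oo /\ (completed mu).-integrable L (EFin \o (id : T -> R)).
Proof.
move=> L_le0 LE Lgt; have [_ _ _ cL] := LE.
have int_neg (A : set R) : A `<=` L ->
    \int[completed mu]_(x in A) (x : R)%:E =
    - \int[completed mu]_(x in A) `|x : R|%:E.
  move=> AL; rewrite -integral_ge0N//; apply: eq_integral => x /set_mem Ax.
  by rewrite ler0_norm ?EFinN ?oppeK// L_le0//; exact: AL.
have [K K0 LK] : exists2 K : R, (0 < K)%R & (- K)%:E < ext_mean mu L.
  case: (ext_mean mu L) Lgt => // [r _|_]; last first.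
    by exists 1%R => //; exact: ltry.
  exists (`|r| + 1)%R; first exact: ltr_wpDl.
  by rewrite lte_fin ltrNl (le_lt_trans (ler_norm _))// normrN ltrDl.
have LtK : \forall p \near trunc_filter mu L, (- K)%:E < trunc_mean mu L p.
  exact: cL (open_ereal_gt' LK).
apply: (integrable_of_bounded_trunc_mean LE K0) => [A _ AL|].
  by rewrite int_neg// abseN gee0_abs//; exact: integral_ge0.
have mean_le0 p : trunc_mean mu L p <= 0.
  rewrite /trunc_mean /mean int_neg; last by move=> ? [].
  by rewrite mulNe oppe_le0 mule_ge0 ?inve_ge0//; exact: integral_ge0.
by apply: filterS LtK => p Kp; rewrite lee0_abs// lteNl.
Qed.

End Caratheodory_line.

(** * Gluing the two half-lines *)

Theorem proposition5p2 (R : realType)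
    (mu : {measure set (measurableTypeR R) -> \bar R}) (H : set R)
    (HnegE : ext_mean_exists mu (H `&` `]-oo, 0%R]))
    (HposE : ext_mean_exists mu (H `&` `[0%R, +oo[))
    (Hneg : -oo < ext_mean mu (H `&` `]-oo, 0%R]))
    (Hpos : ext_mean mu (H `&` `[0%R, +oo[) < +oo) :
  ext_mean_exists mu H /\ `|ext_mean mu H| < +oo.
Proof.
set T := caratheodory_type (mu^*)%mu.
pose N := H `&` `]-oo, 0%R]; pose P := H `&` `[0%R, +oo[.
have HE : H = N `|` P.
  rewrite -setIUr -[LHS]setIT; congr (_ `&` _).
  apply/esym/seteqP; split=> // x _.
  by have [x0|x0] := leP x 0%R; [left|right]; rewrite /= in_itv //= ltW.
have [mN _ _ _] := HnegE; have [mP P0 _ _] := HposE.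
have [Noo Nint] : completed mu N < +oo /\
    (completed mu).-integrable N (EFin \o (id : T -> R)).
  apply: (integrable_of_ext_mean_gtninfty _ HnegE Hneg) => x [_ /=].
  by rewrite in_itv.
have [Poo Pint] : completed mu P < +oo /\
    (completed mu).-integrable P (EFin \o (id : T -> R)).
  apply: (integrable_of_ext_mean_ltpinfty _ HposE Hpos) => x [_ /=].
  by rewrite in_itv /= andbT.
have mH : mu_measurable mu H by rewrite HE; exact: measurableU.
have H0 : 0 < completed mu H.
  apply: lt_le_trans P0 _.
  apply: le_measure; rewrite ?inE; [exact: mP|exact: mH|move=> ? []//].
have Hoo : completed mu H < +oo.
  rewrite HE; apply: le_lt_trans (measureU2 (completed mu) mN mP) _.
  exact: lte_add_pinfty.
have iH : (completed mu).-integrable H (EFin \o (id : T -> R)).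
  by rewrite HE; exact: integrable_setU.
have [l lH] := cvg_trunc_mean mH H0 Hoo iH.
split.
  split=> //; last by apply/cvg_ex; exists l%:E.
  move=> x y _; apply: le_lt_trans Hoo.
  apply: le_measure; rewrite ?inE; [|exact: mH|by move=> ? []].
  by apply: measurableI => //; exact: mu_measurable_itv.
have FP := trunc_filter_proper mH H0 Hoo.
by rewrite /ext_mean (cvg_lim (@ereal_hausdorff R) lH) ltry.
Qed.
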